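(* Let $T:J\to\mathbb{R}$ be a saw map satisfying the standing assumptions (all notation as defined in the context). Any trajectory of $T$ (starting in $J$) enters the union $\bigcup_{1\le k\le k^*}J_k\cup J^*$ after a finite number of iterations.
   Context: Saw map. Let $(p_k)_{k\ge0}$, $(r_k)_{k\ge0}$, $(q_k)_{k\ge1}$ be real sequences with $r_0>q_1>r_1>q_2>r_2>\cdots>0$, $q_k\to0$, $r_k\to 0$; $p_0>p_1>p_2>\cdots>0$; $p_0<r_0$; and $p_k>r_k$ for all $k\ge1$. Put $J=[0,r_0]$ and let $T:J\to\mathbb{R}$ be the map with $T(0)=T(q_k)=0$ for $k\ge1$, $T(r_k)=p_k$ for $k\ge0$, and $T$ linear (i.e. affine) on each of the intervals $[q_{k+1},r_k]$, $[r_k,q_k]$ ($k\ge1$) and $[q_1,r_0]$. Then $T(J)\subset J$. For $k\ge1$, $T$ has a unique fixed point $e_k$ in $(q_{k+1},r_k)$. Let $\alpha_k=p_k/(r_k-q_{k+1})$ ($k\ge0$) and $\beta_k=p_k/(q_k-r_k)$ ($k\ge1$) be the absolute values of the slopes of $T$ on $[q_{k+1},r_k]$ and $[r_k,q_k]$. Standing assumptions: (1) the sequences $\alpha_k$ and $\beta_k$ are increasing; (2) there exists $k^*\ge1$ such that $p_k>e_{k-1}$ for all $k\ge k^*+1$ and, if $k^*\ge2$, $p_k<e_{k-1}$ for $2\le k\le k^*$; (3) $q_k+\frac{e_k}{\alpha_{k-1}}>p_k$ for $1\le k\le k^*-1$. Notation: $J^*=[0,p_{k^*}]$ and $J_k=[e_k,p_k]$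 for $1\le k\le k^*$. *)

(* Defs.v *)
From HB Require Import structures.
From mathcomp Require Import all_boot all_order all_algebra.
From mathcomp Require Import all_classical all_reals all_analysis.
Set Implicit Arguments.
Unset Strict Implicit.
Unset Printing Implicit Defensive.
Import Order.TTheory GRing.Theory Num.Theory.
Import numFieldNormedType.Exports.
Local Open Scope classical_set_scope.
Local Open Scope ring_scope.

Definition affine_on (R : realType) (f : R -> R) (a b : R) : Prop :=
  exists c d : R, forall x : R, x \in `[a, b] -> f x = c * x + d.

(* The sequence q is indexed by k >= 1: its value q 0 is never used.  The map
   T is total on R, but only its values on `[0, r 0] are constrained. *)
Record saw_map (R : realType) (p r q : R^nat) (T : R -> R) : Prop := SawMap {
  saw_qr : forall k, (1 <= k)%N -> r k < q k;
  saw_rq : forall k, q k.+1 < r k;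
  saw_q_gt0 : forall k, (1 <= k)%N -> 0 < q k;
  saw_r_gt0 : forall k, 0 < r k;
  saw_q_cvg0 : q @ \oo --> (0 : R);
  saw_r_cvg0 : r @ \oo --> (0 : R);
  saw_p_decr : forall k, p k.+1 < p k;
  saw_p_gt0 : forall k, 0 < p k;
  saw_p0_lt : p 0%N < r 0%N;
  saw_p_gt : forall k, (1 <= k)%N -> r k < p k;
  saw_T0 : T 0 = 0;
  saw_Tq : forall k, (1 <= k)%N -> T (q k) = 0;
  saw_Tr : forall k, T (r k) = p k;
  (* k = 0 is the interval [q_1, r_0] *)
  saw_affine_qr : forall k, affine_on T (q k.+1) (r k);
  saw_affine_rq : forall k, (1 <= k)%N -> affine_on T (r k) (q k)
}.

(* For a saw map the fixed point of T in ]q_{k+1}, r_k[ exists and is unique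
   for k >= 1, so this determines e k for k >= 1; e 0 is never used. *)
Definition saw_fixed_points (R : realType) (r q : R^nat) (T : R -> R)
    (e : R^nat) : Prop :=
  forall k, (1 <= k)%N -> q k.+1 < e k < r k /\ T (e k) = e k.

Definition saw_alpha (R : realType) (p r q : R^nat) : R^nat :=
  fun k => p k / (r k - q k.+1).

(* meaningful for k >= 1 *)
Definition saw_beta (R : realType) (p r q : R^nat) : R^nat :=
  fun k => p k / (q k - r k).

(* "Increasing" is taken in the wide sense, which includes the strict one;
   beta is shifted because it is indexed by k >= 1. *)
Record saw_standing (R : realType) (p r q e : R^nat) (kstar : nat) : Prop :=
  SawStanding {
  saw_alpha_incr : nondecreasing_seq (saw_alpha p r q);
  saw_beta_incr : nondecreasing_seq (fun k => saw_beta p r q k.+1);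
  saw_kstar_ge1 : (1 <= kstar)%N;
  saw_kstar_above : forall k, (kstar.+1 <= k)%N -> e k.-1 < p k;
  saw_kstar_below : forall k, (2 <= k <= kstar)%N -> p k < e k.-1;
  saw_gap : forall k, (1 <= k <= kstar.-1)%N ->
    p k < q k + e k / saw_alpha p r q k.-1
}.

Definition saw_J (R : realType) (r : R^nat) : set R := `[0, r 0%N]%classic.

Definition saw_Jk (R : realType) (p e : R^nat) (k : nat) : set R :=
  `[e k, p k]%classic.

Definition saw_Jstar (R : realType) (p : R^nat) (kstar : nat) : set R :=
  `[0, p kstar]%classic.

(* Main.v *)
Require Import Defs.
From mathcomp Require Import all_boot all_order all_algebra.
From mathcomp Require Import all_classical all_reals all_analysis.
From mathcomp Require Import lra.
Import Order.TTheory GRing.Theory Num.Theory.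
Import numFieldNormedType.Exports.
Local Open Scope classical_set_scope.
Local Open Scope ring_scope.

(** The points of [0, p_1] outside the target set form the gaps
    (p_{k+1}, e_k), 1 <= k < kstar, so it suffices to push every trajectory
    down through the gaps one at a time.

    On [q_{k+1}, e_k) the map is affine and lies strictly below the diagonal:
    it vanishes at q_{k+1} and meets the diagonal only at e_k.  A trajectory
    starting there therefore loses at least a fixed amount at each step until
    it drops into [0, q_{k+1}] (lemma [affine_descent]).  Since T <= p_{k+1} on
    [0, q_{k+1}] (lemma [saw_tail_bound], from the monotonicity of the peaks),
    one further step leads into [0, p_{k+1}].  There the point is at or above
    e_{k+1}, hence in J_{k+1}, or below it, and the argument repeats with k+1
    until [0, p_kstar] = J^* is reached.  The start is the same: T is below the
    diagonal on [q_1, r_0] because p_0 < r_0, so any trajectory reaches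
    [0, p_1]. *)

(** * Affine maps on an interval *)

(** Convex coordinates turn every estimate on an affine piece into an estimate
    at its two endpoints. *)
Lemma affine_on_convex (R : realType) (f : R -> R) (a b x : R) :
  affine_on f a b -> a <= x <= b ->
  exists t : R, [/\ 0 <= t <= 1, x = (1 - t) * a + t * b &
                    f x = (1 - t) * f a + t * f b].
Proof.
move=> [c [d fE]] /andP[ax xb].
have [ab|ba] := ltP a b; last first.
  have -> : x = a by lra.
  by exists 0; split; lra.
have ba0 : 0 < b - a by rewrite subr_gt0.
have ba_neq0 : b - a != 0 by rewrite gt_eqF.
have xE : (x - a) / (b - a) * (b - a) = x - a by rewrite mulfVK.
exists ((x - a) / (b - a)); split.
- rewrite divr_ge0 ?subr_ge0 //; last exact: ltW.
  by rewrite ler_pdivrMr // mul1r lerD2r.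
- by move: xE; set t := _ / _; lra.
- rewrite !fE ?in_itv /= ?lexx ?ax ?xb ?(ltW ab) //.
  move: xE; set t := _ / _ => xE.
  have -> : x = a + t * (b - a) by rewrite xE; lra.
  lra.
Qed.

Lemma affine_on_bounds (R : realType) (f : R -> R) (a b x m M : R) :
  affine_on f a b -> a <= x <= b ->
  m <= f a <= M -> m <= f b <= M -> m <= f x <= M.
Proof.
move=> faff /(affine_on_convex _ _ _ _ _ faff)[t [/andP[t0 t1] _ ->]].
move=> /andP[ma Ma] /andP[mb Mb]; apply/andP; split; nra.
Qed.

Lemma affine_on_subr (R : realType) (f : R -> R) (a b x : R) :
  x <= b -> affine_on f a b -> affine_on f a x.
Proof.
move=> xb [c [d fE]]; exists c, d => y; rewrite !in_itv /= => /andP[ay yx].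
by apply: fE; rewrite in_itv /= ay (le_trans yx xb).
Qed.

(** An affine map below the diagonal at both endpoints of [a, b] lies below it
    by at least the smaller of the two endpoint gaps, so each step in [a, b]
    decreases the point by that amount and the orbit must leave through a. *)
Lemma affine_descent (R : realType) (f : R -> R) (a b x : R) :
  affine_on f a b -> 0 <= f a < a -> 0 <= f b < b -> a <= x <= b ->
  exists n, 0 <= iter n f x <= a.
Proof.
move=> faff /andP[fa0 faa] /andP[fb0 fbb].
pose gap := Order.min (a - f a) (b - f b).
have gap_gt0 : 0 < gap by rewrite lt_min !subr_gt0 faa fbb.
have gap_a : gap <= a - f a by rewrite ge_min lexx.
have gap_b : gap <= b - f b by rewrite ge_min lexx orbT.
have step y : a <= y <= b -> 0 <= f y <= y - gap.
  move=> /(affine_on_convex _ _ _ _ _ faff)[t [/andP[t0 t1] -> ->]].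
  by apply/andP; split; nra.
have descend n y : a <= y <= b -> y <= a + n%:R * gap ->
    exists m, 0 <= iter m f y <= a.
  elim: n y => [|n IHn] y yab yn; first by exists 0%N => /=; lra.
  have /andP[fy0 fyy] := step y yab.
  have [fya|afy] := leP (f y) a; first by exists 1%N; rewrite /= fy0 fya.
  have [||m Hm] := IHn (f y).
  - by lra.
  - by rewrite -natr1 in yn; lra.
  - by exists m.+1; rewrite iterSr.
move=> xab; have /archi_boundP : 0 <= (x - a) / gap.
  by rewrite divr_ge0 ?(ltW gap_gt0) // subr_ge0; case/andP: xab.
rewrite ltr_pdivrMr // => bnd.
by apply: (descend (Num.bound ((x - a) / gap))) => //; lra.
Qed.

(** * The saw map *)

Section Saw.
Context {R : realType} (p r q e : R^nat) (T : R -> R).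
Hypothesis sawT : saw_map p r q T.
Hypothesis fixT : saw_fixed_points r q T e.

Let p_nonincr : {homo p : m n / (m <= n)%N >-> n <= m}.
Proof. by apply/nonincreasing_seqP => n; exact/ltW/(saw_p_decr sawT). Qed.

Let q1_gt0 k : 0 < q k.+1.
Proof. exact: (saw_q_gt0 sawT). Qed.

(** As q tends to 0, every point of (0, q_k] lies in a tooth [q_{j+1}, q_j]
    with j >= k. *)
Lemma saw_tooth k x : 0 < x <= q k ->
  exists2 j, (k <= j)%N & q j.+1 <= x <= q j.
Proof.
move=> /andP[x0 xq].
have [N _ qN] := cvgr_lt _ (saw_q_cvg0 sawT) _ x0.
have exj : exists j, (k <= j)%N && (q j.+1 <= x).
  exists (maxn k N); rewrite leq_maxl /=; apply/ltW/qN => /=.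
  exact/leqW/leq_maxr.
case: (ex_minnP exj) => j /andP[kj qjx] jmin; exists j => //.
rewrite qjx /=; move: kj; rewrite leq_eqVlt => /predU1P[<- //|].
case: j qjx jmin => // j _ jmin kj.
rewrite leNgt; apply/negP => qx.
by have := jmin j; rewrite (ltW qx) -ltnS kj ltnn => /(_ isT).
Qed.

(** The peaks get lower towards the left, so on [0, q_k] the highest is p_k. *)
Lemma saw_tail_bound k x : (1 <= k)%N -> 0 <= x <= q k -> 0 <= T x <= p k.
Proof.
move=> k1 /andP[]; rewrite le_eqVlt => /predU1P[<- _|x0 xq].
  by rewrite (saw_T0 sawT) lexx ltW // (saw_p_gt0 sawT).
have [|j kj /andP[qx xqj]] := saw_tooth k x; first by rewrite x0.
have j1 := leq_trans k1 kj.
have pj0 := ltW (saw_p_gt0 sawT j).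
suff /andP[-> Tp] : 0 <= T x <= p j by exact: le_trans Tp (p_nonincr _ _ kj).
have Tr : 0 <= T (r j) <= p j by rewrite (saw_Tr sawT) pj0 lexx.
have [xr|rx] := leP x (r j).
- apply: (affine_on_bounds _ _ _ _ _ _ _ (saw_affine_qr sawT j)) => //.
    by rewrite qx.
  by rewrite (saw_Tq sawT) // lexx.
- apply: (affine_on_bounds _ _ _ _ _ _ _ (saw_affine_rq sawT j1)) => //.
    by rewrite (ltW rx).
  by rewrite (saw_Tq sawT) // lexx.
Qed.

(** Below a point b of the rising branch [q_{k+1}, r_k] where T is under the
    diagonal, the orbit slides down that branch to [0, q_{k+1}], and the next
    value is at most the peak p_{k+1}. *)
Lemma saw_descend k b x : q k.+1 <= b <= r k -> 0 <= T b < b -> 0 <= x <= b ->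
  exists n, 0 <= iter n T x <= p k.+1.
Proof.
move=> /andP[qb br] Tb /andP[x0 xb].
have [xq|qx] := leP x (q k.+1).
  by exists 1%N; apply: saw_tail_bound => //; rewrite x0.
have Taff := affine_on_subr _ _ _ _ _ br (saw_affine_qr sawT k).
have [||n Hn] := affine_descent _ _ _ _ x Taff _ Tb.
- by rewrite (saw_Tq sawT) // lexx q1_gt0.
- by rewrite (ltW qx).
- by exists n.+1; apply: saw_tail_bound.
Qed.

(** The fixed point e_k repels to the left, because the branch through it
    starts from the value 0 at q_{k+1}, strictly below the diagonal. *)
Lemma saw_below_fixed_point k x : (1 <= k)%N -> q k.+1 <= x < e k ->
  0 <= T x < x.
Proof.
move=> k1 /andP[qx xe]; have [/andP[qe er] Te] := fixT k k1.
have Taff := affine_on_subr _ _ _ _ _ (ltW er) (saw_affine_qr sawT k).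
have [|t [/andP[t0 t1] xE ->]] := affine_on_convex _ _ _ _ x Taff.
  by rewrite qx ltW.
rewrite (saw_Tq sawT) // Te.
have q0 := q1_gt0 k.
(* x < e_k excludes t = 1, so q_{k+1} contributes positively to x. *)
have t_lt1 : t < 1.
  rewrite lt_neqAle t1 andbT; apply/eqP => t_eq1; move: xE xe.
  by rewrite t_eq1 => ->; lra.
have tq : 0 < (1 - t) * q k.+1 by rewrite mulr_gt0 // subr_gt0.
by rewrite xE; apply/andP; split; nra.
Qed.

Lemma saw_pass_gap k x : (1 <= k)%N -> 0 <= x < e k ->
  exists n, 0 <= iter n T x <= p k.+1.
Proof.
move=> k1 /andP[x0 xe]; have [/andP[qe er] _] := fixT k k1.
have [xq|qx] := leP x (q k.+1).
  by exists 1%N; apply: saw_tail_bound => //; rewrite x0.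
apply: (saw_descend k x); rewrite ?x0 ?lexx //.
  by rewrite (ltW qx) ltW // (lt_trans xe).
by apply: (saw_below_fixed_point k) => //; rewrite (ltW qx).
Qed.

Lemma saw_enters_first_peak x : 0 <= x <= r 0%N ->
  exists n, 0 <= iter n T x <= p 1%N.
Proof.
apply: saw_descend; first by rewrite lexx ltW // (saw_rq sawT).
by rewrite (saw_Tr sawT) ltW ?(saw_p_gt0 sawT) // (saw_p0_lt sawT).
Qed.

(** The induction is on the number of gaps left between p_k and p_kstar. *)
Lemma saw_enters_below_peak kstar k x : (1 <= k <= kstar)%N -> 0 <= x <= p k ->
  exists n, (\bigcup_(j in [set j | (1 <= j <= kstar)%N]) saw_Jk p e j
             `|` saw_Jstar p kstar) (iter n T x).
Proof.
move=> /andP[k1 /subnK <-].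
move: (kstar - k)%N => gaps; elim: gaps k k1 x => [|d IHd] k k1 x /andP[x0 xp].
  by exists 0%N; right; rewrite /saw_Jstar /= in_itv /= x0.
have [ex|xe] := leP (e k) x.
  exists 0%N; left; exists k; first by rewrite /= k1 leq_addl.
  by rewrite /saw_Jk /= in_itv /= ex.
have [|m xm] := saw_pass_gap k x k1; first by rewrite x0.
have [//|n Hn] := IHd k.+1 _ _ xm.
by exists (n + m)%N; rewrite iterD addSnnS.
Qed.

End Saw.

Theorem theorem2p3 (R : realType) (p r q e : R^nat) (T : R -> R)
    (kstar : nat) :
  saw_map p r q T ->
  saw_fixed_points r q T e ->
  saw_standing p r q e kstar ->
  forall x : R, saw_J r x ->
  exists n : nat,
    (\bigcup_(k in [set k | (1 <= k <= kstar)%N]) saw_Jk p e k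
       `|` saw_Jstar p kstar) (iter n T x).
Proof.
move=> sawT fixT standing x; rewrite /saw_J /= in_itv /= => xJ.
have [m xm] := saw_enters_first_peak _ _ _ _ sawT _ xJ.
have k1 : (1 <= 1 <= kstar)%N by rewrite (saw_kstar_ge1 standing).
have [n Hn] := saw_enters_below_peak _ _ _ _ _ sawT fixT _ _ _ k1 xm.
by exists (n + m)%N; rewrite iterD.
Qed.
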